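(* (1) Let $\rho$ be a positive real number and $\mathcal{U}$ a unit shape. Then the following three conditions are equivalent: (i) $\rho\leq\Pi_{\mathcal{U}}$; (ii) for some positive real number $\kappa$ and some shape $\mathcal{U}_{\kappa}$ that is $\kappa$-similar to $\mathcal{U}$ we have $\rho\,A(\mathcal{U}_{\kappa})\leq S(\mathcal{U}_{\kappa})^{2}$; (iii) for every positive real number $\kappa$ and any shape $\mathcal{U}_{\kappa}$ that is $\kappa$-similar to $\mathcal{U}$ we have $\rho\,A(\mathcal{U}_{\kappa})\leq S(\mathcal{U}_{\kappa})^{2}$. (2) Let $\mathscr{S}$ be a collection of shapes with the property that if $\mathcal{C}$ is in $\mathscr{S}$, then for any positive real number $\lambda$ there exists $\mathcal{D}$ in $\mathscr{S}$ such that $\mathcal{C}\sim_{\lambda}\mathcal{D}$. Suppose $\rho$ is a positive lower bound of the fundamental measures of all unit shapes in $\mathscr{S}$. Then $\rho\,A(\mathcal{C})\leq S(\mathcal{C})^{2}$ for all shapes $\mathcal{C}$ in $\mathscr{S}$.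
   Context: A curve $[a,b]\to\mathbb{R}^2$, $t\mapsto(x(t),y(t))$, is nicely rectifiable if it is continuously differentiable on $[a,b]$ (one-sided derivatives at the endpoints) and $x'(t),y'(t)$ never vanish simultaneously; it is piecewise nice if it is continuous and there is a partition $a=a_0<a_1<\cdots<a_n=b$ such that its restriction to each $[a_{i-1},a_i]$ is nicely rectifiable. A shape $\mathcal{C}$ is a piecewise nice simple closed curve in the Euclidean plane $\mathbb{R}^2$; it is identified with its image. For a shape $\mathcal{C}$, the region $R(\mathcal{C})$ enclosed by $\mathcal{C}$ is the union of $\mathcal{C}$ and the bounded component of $\mathbb{R}^2\setminus\mathcal{C}$. The area is $A(\mathcal{C}) := \iint_{R(\mathcal{C})}1\,dx\,dy$. The perimeter is $P(\mathcal{C}) := \sum_{i=1}^n\int_{a_{i-1}}^{a_i}\sqrt{x_{\mathcal{C}}'(t)^2+y_{\mathcal{C}}'(t)^2}\,dt$ (where the subintervals correspond to the nicely rectifiable pieces), and the semiperimeter is $S(\mathcal{C}) := \tfrac12P(\mathcal{C})$. A rigid motion of $\mathbb{R}^2$ is a composition of a rotation about the origin, possibly followed by a reflection across a line through the origin, followed by a translation. For a positive real number $\lambda$, $L_\lambda:\mathbb{R}^2\to\mathbb{R}^2$ is the scaling $L_\lambda(x,y)=(\lambda x,\lambda y)$. A shape $\mathcal{D}$ is $\lambda$-similar to $\mathcal{C}$, written $\mathcal{C}\sim_\lambda\mathcal{D}$, if $\mathcal{D}=(L_\lambda\circ M)(\mathcal{C})$ for some rigid motion $M$. A unit shape is a shape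 $\mathcal{U}$ with $A(\mathcal{U})=S(\mathcal{U})$; its fundamental measure is $\Pi_{\mathcal{U}}:=A(\mathcal{U})=S(\mathcal{U})$. *)

(* Defs.v *)
From HB Require Import structures.
From mathcomp Require Import all_boot all_order all_algebra.
From mathcomp Require Import all_classical all_reals all_analysis.

Set Implicit Arguments.
Unset Strict Implicit.
Unset Printing Implicit Defensive.

Import Order.TTheory GRing.Theory Num.Theory.
Import numFieldNormedType.Exports.

Local Open Scope classical_set_scope.
Local Open Scope ring_scope.

(* Derivative at [t] of [f] restricted to [[c, d]]: one-sided at [c] and [d],
   the usual derivative in between; values of [f] outside [[c, d]] are never
   used. *)
Definition slope (R : realType) (f : R -> R) (t s : R) : R :=
  (f s - f t) / (s - t).

Definition derivable_on (R : realType) (c d : R) (f : R -> R) (t : R) : Prop :=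
  cvg (slope f t s @[s --> within `[c, d] t^']).

Definition derive_on (R : realType) (c d : R) (f : R -> R) (t : R) : R :=
  lim (slope f t s @[s --> within `[c, d] t^']).

Definition continuously_differentiable (R : realType) (c d : R) (f : R -> R)
    : Prop :=
  (forall t, t \in `[c, d] -> derivable_on c d f t) /\
  {within `[c, d], continuous (derive_on c d f)}.

Definition xcoord (R : realType) (g : R -> R * R) (t : R) : R := (g t).1.
Definition ycoord (R : realType) (g : R -> R * R) (t : R) : R := (g t).2.

Definition nicely_rectifiable (R : realType) (c d : R) (g : R -> R * R)
    : Prop :=
  [/\ continuously_differentiable c d (xcoord g),
      continuously_differentiable c d (ycoord g) &
      forall t, t \in `[c, d] ->
        ~ (derive_on c d (xcoord g) t = 0 /\ derive_on c d (ycoord g) t = 0)].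

Definition arc_length (R : realType) (c d : R) (g : R -> R * R) : R :=
  \int[lebesgue_measure]_(t in `[c, d])
    Num.sqrt (derive_on c d (xcoord g) t ^+ 2 +
              derive_on c d (ycoord g) t ^+ 2).

(* A partition a = a_0 < a_1 < ... < a_n = b is the sequence
   [s = [:: a_1; ...; a_n]], so that a_i is [nth b (a :: s) i].
   [curve] is a total function of which only the restriction to [[lo, hi]]
   matters. *)
Record planar_shape (R : realType) := PlanarShape {
  lo : R;
  hi : R;
  curve : R -> R * R;
  breaks : seq R;
  lo_lt_hi : lo < hi;
  curve_continuous : {within `[lo, hi], continuous curve};
  breaks_partition : itv_partition lo hi breaks;
  curve_nice : forall i, (i < size breaks)%N ->
    nicely_rectifiable (nth hi (lo :: breaks) i)
                       (nth hi (lo :: breaks) i.+1) curve;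
  curve_closed : curve lo = curve hi;
  curve_simple : {in `[lo, hi[ &, injective curve}
}.

(* Shapes are identified with their images: every relation between shapes is
   stated on [shape_image]; different shapes may parametrize the same image. *)
Definition shape_image (R : realType) (C : planar_shape R) : set (R * R) :=
  curve C @` `[lo C, hi C].

(* By the Jordan curve theorem exactly one component of the complement is
   bounded; it is obtained here as the union of the bounded components. The
   norm on [R * R] is the sup norm, which has the same bounded sets and
   topology as the Euclidean one. *)
Definition region (R : realType) (C : planar_shape R) : set (R * R) :=
  shape_image C `|`
  [set z | (~` shape_image C) z /\
           bounded_set (connected_component (~` shape_image C) z)].

Definition area (R : realType) (C : planar_shape R) : R :=
  \int[(@lebesgue_measure R \x @lebesgue_measure R)%E]_(z in region C) 1.

Definition perimeter (R : realType) (C : planar_shape R) : R :=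
  \sum_(i < size (breaks C))
    arc_length (nth (hi C) (lo C :: breaks C) i)
               (nth (hi C) (lo C :: breaks C) i.+1) (curve C).

Definition semiperimeter (R : realType) (C : planar_shape R) : R := perimeter C / 2.

Definition rotation (R : realType) (theta : R) (z : R * R) : R * R :=
  (cos theta * z.1 - sin theta * z.2, sin theta * z.1 + cos theta * z.2).

(* Reflection across the line spanned by (cos phi, sin phi). *)
Definition reflection (R : realType) (phi : R) (z : R * R) : R * R :=
  (cos (2 * phi) * z.1 + sin (2 * phi) * z.2,
   sin (2 * phi) * z.1 - cos (2 * phi) * z.2).

Definition translation (R : realType) (v z : R * R) : R * R := z + v.

Definition rigid_motion (R : realType) (M : R * R -> R * R) : Prop :=
  exists (theta : R) (v : R * R),
    M = translation v \o rotation theta \/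
    exists phi : R, M = translation v \o reflection phi \o rotation theta.

Definition scaling (R : realType) (lambda : R) (z : R * R) : R * R :=
  (lambda * z.1, lambda * z.2).

Definition similar_by (R : realType) (lambda : R) (C D : planar_shape R) : Prop :=
  exists M : R * R -> R * R,
    rigid_motion M /\ shape_image D = (scaling lambda \o M) @` shape_image C.

Definition unit_shape (R : realType) (U : planar_shape R) : Prop :=
  area U = semiperimeter U.

(* Only meaningful on unit shapes, where it is also the semiperimeter. *)
Definition fundamental_measure (R : realType) (U : planar_shape R) : R := area U.

(* Main.v *)
Require Import Defs.
From mathcomp Require Import all_boot all_order all_algebra.
From mathcomp Require Import all_classical all_reals all_analysis.
From mathcomp Require Import measurable_realfun ring lra.

(** A similarity of ratio k multiplies areas by k^2 and lengths by k.  Granting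
    this, part (1) is the remark that both sides of rho A <= S^2 scale by k^2, so
    that on the similarity class of a unit shape U the inequality always reads
    rho Pi <= Pi^2, that is rho <= Pi, because Pi = S(U) > 0.  For part (2),
    the inequality is clear if A(C) <= 0; otherwise a copy of C scaled by S/A is
    a unit shape, of measure S^2/A, and the lower bound rho applies to it.

    The work lies in the scaling laws, because similar shapes are only assumed to
    have similar images: nothing relates their parametrizations.

    Area.  A similarity is a homeomorphism that preserves boundedness, so it
    carries the bounded components of the complement of one curve to those of
    the other ([similarity_region]).  The region is a Borel set
    ([region_measurable]), and an affine map multiplies plane measure by the
    absolute value of its determinant, by factoring its matrix into shears, a
    diagonal matrix and an exchange of coordinates ([multiplies_area_affine]).

    Perimeter.  Parametrizations are never compared.  Instead the curve D gives
    a set function [length_on D] on the plane: the part of D inside a set X is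
    unrolled onto a line by arc length and measured there.  It is at most the
    perimeter of D, it is superadditive when one of the two disjoint sets is
    closed, and it dominates the measure of the projection of X to any line,
    since a projection is 1-Lipschitz for arc length.  Let T map the image of C
    onto that of D, and let phi t be the [length_on D] of the T-image of the
    initial arc of C up to t.  The last two properties show that phi grows over
    [s, t] by at least k times the displacement of C between s and t in any
    direction.  In the direction of the tangent this displacement has slope the
    speed of C, so phi grows by at least k times the arc length of C
    ([arc_length_le]).  Hence k P(C) <= P(D) ([perimeter_similarity_le]), and the
    inverse similarity gives the opposite inequality. *)

Set Implicit Arguments.
Unset Strict Implicit.
Unset Printing Implicit Defensive.

Import Order.TTheory GRing.Theory Num.Theory.
Import numFieldNormedType.Exports.

Local Open Scope classical_set_scope.
Local Open Scope ring_scope.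

(** * Similarities of the plane *)

Definition affine (R : realType) (a b c d : R) (v z : R * R) : R * R :=
  (a * z.1 + b * z.2 + v.1, c * z.1 + d * z.2 + v.2).

(** Normal form of L_k o M: (p, q) is k times a unit vector, and e = 1 or e = -1
    according to whether the orientation is kept or reversed. *)
Definition similarity (R : realType) (k : R) (T : R * R -> R * R) : Prop :=
  exists (p q e : R) (v : R * R),
    [/\ e ^+ 2 = 1, p ^+ 2 + q ^+ 2 = k ^+ 2 &
        T = affine p (- (e * q)) q (e * p) v].

Lemma scaling_rigid_motion_similarity (R : realType) (k : R)
    (M : R * R -> R * R) :
  rigid_motion M -> similarity k (scaling k \o M).
Proof.
move=> [theta [v [->|[phi ->]]]].
  exists (k * cos theta), (k * sin theta), 1, (k * v.1, k * v.2); split.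
  - by rewrite expr1n.
  - by rewrite !exprMn -mulrDr cos2Dsin2 mulr1.
  - by apply/funext => -[x y]; rewrite /affine /scaling /translation /rotation /=;
       congr pair; ring.
pose c := cos (2 * phi) * cos theta + sin (2 * phi) * sin theta.
pose s := sin (2 * phi) * cos theta - cos (2 * phi) * sin theta.
exists (k * c), (k * s), (-1), (k * v.1, k * v.2); split.
- by rewrite sqrrN expr1n.
- have h1 := cos2Dsin2 (2 * phi); have h2 := cos2Dsin2 theta.
  transitivity (k ^+ 2 * ((cos (2 * phi) ^+ 2 + sin (2 * phi) ^+ 2) *
                          (cos theta ^+ 2 + sin theta ^+ 2))).
    by rewrite /c /s; ring.
  by rewrite h1 h2 !mulr1.
- by apply/funext => -[x y]; 
  rewrite /affine /scaling /translation /reflection /rotation /c /s /=;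
  congr pair; ring.
Qed.

Lemma similarity_inverse (R : realType) (k : R) (T : R * R -> R * R) :
  0 < k -> similarity k T ->
  exists S : R * R -> R * R, [/\ similarity k^-1 S, cancel T S & cancel S T].
Proof.
move=> k0 [p [q [e [v [e1 pq ->]]]]].
have k2 : k ^+ 2 != 0 by rewrite expf_neq0// gt_eqF.
have pq0 : p ^+ 2 + q ^+ 2 != 0 by rewrite pq.
exists (affine (p / k ^+ 2) (q / k ^+ 2) (- (e * q) / k ^+ 2) (e * p / k ^+ 2)
  (- (p * v.1 + q * v.2) / k ^+ 2,
   - e * (p * v.2 - q * v.1) / k ^+ 2)); split.
- exists (p / k ^+ 2), (- (e * q) / k ^+ 2), e,
    (- (p * v.1 + q * v.2) / k ^+ 2,
     - e * (p * v.2 - q * v.1) / k ^+ 2); split => //.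
  + rewrite -pq exprVn -pq.
    transitivity ((p ^+ 2 + e ^+ 2 * q ^+ 2) / (p ^+ 2 + q ^+ 2) ^+ 2).
      by field.
    by rewrite e1 mul1r; field.
  + congr affine.
      rewrite mulNr mulrN opprK mulrA mulrA -expr2 e1 mul1r//.
    by rewrite mulrA.
- move=> -[x y]; rewrite /affine -pq /=; congr pair.
  + by field.
  + transitivity (e ^+ 2 * y); last by rewrite e1 mul1r.
    by field.
- move=> -[x y]; rewrite /affine -pq /=; congr pair.
  + transitivity (((p ^+ 2 + e ^+ 2 * q ^+ 2) * x +
      (1 - e ^+ 2) * p * q * y
      + (p ^+ 2 + q ^+ 2) * v.1 - p ^+ 2 * v.1 - e ^+ 2 * q ^+ 2 * v.1
      - (1 - e ^+ 2) * p * q * v.2) / (p ^+ 2 + q ^+ 2)); first by field.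
    by rewrite e1; field.
  + transitivity (((q ^+ 2 + e ^+ 2 * p ^+ 2) * y +
      (1 - e ^+ 2) * p * q * x
      + (p ^+ 2 + q ^+ 2) * v.2 - q ^+ 2 * v.2 - e ^+ 2 * p ^+ 2 * v.2
      - (1 - e ^+ 2) * p * q * v.1) / (p ^+ 2 + q ^+ 2)); first by field.
    by rewrite e1; field.
Qed.

Definition dot (R : realType) (u z : R * R) : R := u.1 * z.1 + u.2 * z.2.

(** The linear part of T sends the line of u to the line of v and scales it by
    k, so the coordinate along v of an image is k times the coordinate along u.
    Distances are compared below through such coordinates only. *)
Lemma similarity_dot (R : realType) (k : R) (T : R * R -> R * R) (u : R * R) :
  0 < k -> similarity k T -> dot u u = 1 ->
  exists2 v, dot v v = 1 &
    forall z w, dot v (T z) - dot v (T w) = k * (dot u z - dot u w).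
Proof.
move=> k0 [p [q [e [v [e1 pq ->]]]]]; rewrite /dot => u1.
have k2 : k != 0 by rewrite gt_eqF.
exists ((p * u.1 - e * q * u.2) / k, (q * u.1 + e * p * u.2) / k) => /=.
  transitivity ((p ^+ 2 + q ^+ 2) * (u.1 * u.1 + e ^+ 2 * (u.2 * u.2)) / k ^+ 2).
    by field.
  by rewrite e1 mul1r u1 pq mulr1 divff// expf_neq0.
move=> [z1 z2] [w1 w2] /=.
transitivity ((p ^+ 2 + q ^+ 2) *
   (u.1 * (z1 - w1) + e ^+ 2 * (u.2 * (z2 - w2))) / k).
  by field.
by rewrite e1 mul1r pq; field.
Qed.

Lemma affine_continuous (R : realType) (a b c d : R) (v : R * R) :
  continuous (affine a b c d v).
Proof.
have lin (m n r : R) (w : R * R) :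
    (m * z.1 + n * z.2 + r) @[z --> w] --> m * w.1 + n * w.2 + r.
  apply: cvgD; last exact: cvg_cst.
  by apply: cvgD; apply: cvgM;
    [exact: cvg_cst|exact: cvg_fst|exact: cvg_cst|exact: cvg_snd].
by move=> z; apply: (@cvg_pair _ _ _ _ (nbhs _) (nbhs _)); exact: lin.
Qed.

Lemma similarity_continuous (R : realType) (k : R) (T : R * R -> R * R) :
  similarity k T -> continuous T.
Proof. by move=> [p [q [e [v [_ _ ->]]]]]; exact: affine_continuous. Qed.

(** * Areas under affine maps *)

Local Notation leb := (@lebesgue_measure _).
Local Notation leb2 := (@lebesgue_measure _ \x @lebesgue_measure _)%E.

Lemma affine1_measurable (R : realType) (k b : R) :
  measurable_fun setT (fun x : R => k * x + b).
Proof.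
by apply: measurable_funD => //; apply: measurable_funM.
Qed.

(** Both sides are measures in A, so it is enough to compare them on half-open
    intervals; the preimage of one is an interval of length divided by |k|, with
    its ends exchanged if k < 0. *)
Lemma lebesgue_measure_affine (R : realType) (k b : R) (A : set R) :
  k != 0 -> measurable A ->
  ((leb ((fun x => (k * x + b)%R) @^-1` A) * `|k|%:E)%E = leb A).
Proof.
move=> k0 mA.
pose f : R -> measurableTypeR R := fun x => k * x + b.
have mf : measurable_fun [set: measurableTypeR R] f.
  exact: affine1_measurable.
pose m : {measure set (measurableTypeR R) -> \bar R} :=
  mscale (NngNum (normr_ge0 k)) (pushforward (@lebesgue_measure R) f).
rewrite muleC -[LHS]/(m mf A); apply/esym.
apply: (lebesgue_measure_unique (mu := m mf)) => // X [[x y] _ <-] /=.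
rewrite /mscale /= [RHS]muleC /pushforward.
have [k_lt0|k_gt0|/eqP] := ltgtP k 0; last by rewrite (negbTE k0).
- have -> : f @^-1` `]x, y] = `[(y - b) / k, (x - b) / k[%classic.
    apply/seteqP; split => t; rewrite /= /f !in_itv/=.
      move=> /andP[h1 h2]; rewrite ler_ndivrMr// ltr_ndivlMr//.
      by rewrite ![t * k]mulrC lerBrDr ltrBlDr h1 h2.
    rewrite ler_ndivrMr// ltr_ndivlMr// ![t * k]mulrC lerBrDr ltrBlDr.
    by move=> /andP[-> ->].
  rewrite !lebesgue_measure_itv /= !lte_fin ltr_nM2r ?invr_lt0//.
  rewrite ltrD2r; case: ifPn => _; last by rewrite mul0e.
  rewrite -!EFinB -EFinM ltr0_norm//; congr EFin.
  by field.
- have -> : f @^-1` `]x, y] = `](x - b) / k, (y - b) / k]%classic.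
    apply/seteqP; split => t; rewrite /= /f !in_itv/=.
      move=> /andP[h1 h2]; rewrite ltr_pdivrMr// ler_pdivlMr//.
      by rewrite ![t * k]mulrC ltrBlDr lerBrDr h1 h2.
    rewrite ltr_pdivrMr// ler_pdivlMr// ![t * k]mulrC ltrBlDr lerBrDr.
    by move=> /andP[-> ->].
  rewrite !lebesgue_measure_itv /= !lte_fin ltr_pM2r ?invr_gt0//.
  rewrite ltrD2r; case: ifPn => _; last by rewrite mul0e.
  rewrite -!EFinB -EFinM gtr0_norm//; congr EFin.
  by field.
Qed.

Lemma affine_measurable (R : realType) (a b c d : R) (v : R * R) :
  measurable_fun [set: R * R] (affine a b c d v).
Proof.
have lin (m n r : R) :
    measurable_fun [set: R * R] (fun z : R * R => m * z.1 + n * z.2 + r).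
  apply: measurable_funD => //; apply: measurable_funD;
    by apply: measurable_funM => //.
by apply: measurable_fun_pair; exact: lin.
Qed.

(** Preimages are used instead of images, so that measurability of L yields that
    of the transformed set and composition is a matter of chaining equations. *)
Definition multiplies_area (R : realType) (k : R) (L : R * R -> R * R) : Prop :=
  forall A : set (R * R), measurable A ->
    measurable (L @^-1` A) /\ (leb2 (L @^-1` A) * k%:E = leb2 A)%E.

Lemma multiplies_area_comp (R : realType) (k l : R) (K L : R * R -> R * R) :
  multiplies_area k K -> multiplies_area l L -> multiplies_area (l * k) (K \o L).
Proof.
move=> hK hL A mA; rewrite comp_preimage.
have [mK eK] := hK _ mA; have [mL eL] := hL _ mK.
by split => //; rewrite EFinM muleA eL eK.
Qed.

(** A measure that agrees with the product measure on measurable rectangles is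
    the product measure. *)
Lemma multiplies_area_rectangles (R : realType) (k : R) (L : R * R -> R * R) :
  0 <= k -> measurable_fun [set: R * R] L ->
  (forall A B : set R, measurable A -> measurable B ->
     (leb2 (L @^-1` (A `*` B)) * k%:E = leb A * leb B)%E) ->
  multiplies_area k L.
Proof.
move=> k0 mL LE A mA; split.
  by rewrite -[X in measurable X]setTI; exact: mL.
pose f : R * R -> measurableTypeR R * measurableTypeR R := L.
have mf : measurable_fun [set: measurableTypeR R * measurableTypeR R] f.
  exact: mL.
pose m : {measure set (measurableTypeR R * measurableTypeR R) -> \bar R} :=
  mscale (NngNum k0)
    (pushforward (@lebesgue_measure R \x @lebesgue_measure R)%E f).
rewrite muleC -[LHS]/(m mf A); apply/esym.
apply: (product_measure_unique (m' := m mf)) => // X Y mX mY.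
by rewrite /m /mscale /= [LHS]muleC; exact: LE.
Qed.

Lemma multiplies_area_diagonal (R : realType) (a d : R) (v : R * R) :
  a != 0 -> d != 0 -> multiplies_area `|a * d| (affine a 0 0 d v).
Proof.
move=> a0 d0; apply: multiplies_area_rectangles => //.
  exact: affine_measurable.
move=> A B mA mB.
have -> : affine a 0 0 d v @^-1` (A `*` B) =
    ((fun x => a * x + v.1) @^-1` A) `*` ((fun x => d * x + v.2) @^-1` B).
  by apply/seteqP; split => -[x y];
    rewrite /affine /= !mul0r addr0 add0r.
have mX k b (X : set R) : measurable X ->
    measurable ((fun x => k * x + b) @^-1` X).
  by move=> ?; rewrite -[X in measurable X]setTI; exact: affine1_measurable.
rewrite product_measure1E; [|exact: mX|exact: mX].
rewrite normrM EFinM muleACA.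
by rewrite !lebesgue_measure_affine.
Qed.

Lemma multiplies_area_swap (R : realType) :
  multiplies_area 1 (affine (0 : R) 1 1 0 (0, 0)).
Proof.
apply: multiplies_area_rectangles => //; first exact: affine_measurable.
move=> A B mA mB.
have -> : affine 0 1 1 0 (0, 0) @^-1` (A `*` B) = B `*` A.
  apply/seteqP; split => -[x y];
    rewrite /affine /= !mul0r !mul1r !addr0 !add0r; by case.
by rewrite product_measure1E// mule1 muleC.
Qed.

(** A vertical shear translates every vertical section, and the area is the
    integral of the lengths of the sections. *)
Lemma multiplies_area_shear (R : realType) (c : R) :
  multiplies_area 1 (affine 1 0 c 1 (0, 0)).
Proof.
move=> A mA; split.
  by rewrite -[X in measurable X]setTI; exact: affine_measurable.
rewrite mule1; apply: eq_integral => x _ /=.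
transitivity (leb ((fun y => (1 * y + c * x)%R) @^-1` xsection A x)).
  congr (leb _); apply/seteqP; split => y;
    rewrite /xsection /affine /= !inE /= !mul1r mul0r !addr0 addrC; exact.
rewrite -[LHS]mule1 -[in X in (_ * X)%E](@normr1 R).
by rewrite lebesgue_measure_affine ?oner_neq0//; exact: measurable_xsection.
Qed.

(** If a is nonzero the linear part is the product of a lower shear, a diagonal
    matrix and an upper shear; if a = 0 then c is nonzero, and exchanging the
    rows brings it to the corner. *)
Lemma multiplies_area_affine (R : realType) (a b c d : R) (v : R * R) :
  a * d - b * c != 0 -> multiplies_area `|a * d - b * c| (affine a b c d v).
Proof.
wlog a0 : a b c d v / a != 0 => [hwlog|].
  have [a0|] := eqVneq a 0; last exact: hwlog.
  move=> D0; have c0 : c != 0.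
    by apply: contraNneq D0 => c0; rewrite a0 c0 mul0r mulr0 subrr.
  have D0' : c * b - d * a != 0 by rewrite -oppr_eq0 opprB (mulrC d) (mulrC c).
  have := multiplies_area_comp (@multiplies_area_swap R)
    (hwlog c d a b (v.2, v.1) c0 D0').
  rewrite mulr1 distrC (mulrC c) (mulrC d).
  congr (multiplies_area _ _); apply/funext => -[x y].
  by rewrite /affine /=; congr pair; ring.
move=> D0.
have e0 : d - b * c / a != 0.
  apply: contraNneq D0 => e0.
  have -> : a * d - b * c = a * (d - b * c / a) by field.
  by rewrite e0 mulr0.
(* upper shears are lower shears conjugated by the exchange of coordinates *)
have upper := multiplies_area_comp (multiplies_area_comp (@multiplies_area_swap R)
  (multiplies_area_shear (b / a))) (@multiplies_area_swap R).
have := multiplies_area_comp (multiplies_area_shear (c / a))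
  (multiplies_area_comp
     (multiplies_area_diagonal (v.1, v.2 - c / a * v.1) a0 e0) upper).
rewrite !mulr1 !mul1r.
have -> : a * (d - b * c / a) = a * d - b * c by field.
congr (multiplies_area _ _); apply/funext => -[x y].
by rewrite /affine /=; congr pair; field.
Qed.

Lemma similarity_measure (R : realType) (k : R) (T : R * R -> R * R)
    (A : set (R * R)) :
  0 < k -> similarity k T -> measurable A ->
  measurable (T @^-1` A) /\
  (leb2 (T @^-1` A) * (k ^+ 2)%:E = leb2 A)%E.
Proof.
move=> k0 [p [q [e [v [e1 pq ->]]]]].
have detE : `|p * (e * p) - - (e * q) * q| = k ^+ 2.
  transitivity (`|e| * `|k ^+ 2|); first by rewrite -pq -normrM; congr `|_|; ring.
  have -> : `|e| = 1.
    by have /eqP := e1; rewrite sqrf_eq1 => /orP[] /eqP->; rewrite ?normrN normr1.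
  by rewrite mul1r ger0_norm// sqr_ge0.
rewrite -detE; apply: multiplies_area_affine.
by rewrite -normr_eq0 detE expf_neq0// gt_eqF.
Qed.

(** * The region enclosed by a shape *)

(** An open set is the union of the countably many rational boxes inside it. *)
Lemma open_measurable_plane (R : realType) (A : set (R * R)) :
  open A -> measurable A.
Proof.
move=> oA.
pose box (q : (rat * rat) * (rat * rat)) : set (R * R) :=
  `]ratr q.1.1, ratr q.1.2[%classic `*` `]ratr q.2.1, ratr q.2.2[%classic.
have -> : A = \bigcup_q (if `[< box q `<=` A >] then box q else set0).
  apply/seteqP; split => [[x y] Axy|z [q _]]; last first.
    by case: ifPn => // /asboolP; exact.
  have /nbhs_ballP[e /= e0 zeA] : nbhs (x, y) A by exact: open_nbhs_nbhs.
  have [a] := @rat_in_itvoo R (x - e) x ltac:(lra).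
  have [b] := @rat_in_itvoo R x (x + e) ltac:(lra).
  have [c] := @rat_in_itvoo R (y - e) y ltac:(lra).
  have [d] := @rat_in_itvoo R y (y + e) ltac:(lra).
  rewrite !in_itv/= => /andP[d1 d2] /andP[c1 c2] /andP[b1 b2] /andP[a1 a2].
  exists ((a, b), (c, d)) => //.
  case: ifPn => [_|/asboolP[]].
    by split; rewrite /= in_itv/=; apply/andP.
  move=> [s t] [] /=; rewrite !in_itv/= => /andP[s1 s2] /andP[t1 t2].
  apply: zeA; split; rewrite /ball/= ltr_norml; apply/andP; split; lra.
apply: countable_bigcupT_measurable => // q.
by case: ifPn => // _; apply: measurableX.
Qed.

Lemma shape_image_compact (R : realType) (C : planar_shape R) :
  compact (shape_image C).
Proof.
apply: continuous_compact; last exact: segment_compact.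
exact: (@curve_continuous _ C).
Qed.

Lemma shape_image_closed (R : realType) (C : planar_shape R) :
  closed (shape_image C).
Proof.
apply: compact_closed; last exact: shape_image_compact.
exact: norm_hausdorff.
Qed.

(** The ball contains the segment from z to w.  Consequently the components of an
    open set are open. *)
Lemma ball_connected_component (R : realType) (A : set (R * R)) (z w : R * R)
    (e : R) :
  ball z e `<=` A -> ball z e w -> connected_component A z w.
Proof.
move=> zeA zew.
pose g (t : R) : R * R := (z.1 + t * (w.1 - z.1), z.2 + t * (w.2 - z.2)).
have cg : continuous g.
  move=> t; apply: (@cvg_pair _ _ _ _ (nbhs _) (nbhs _));
  by apply: cvgD; [exact: cvg_cst|apply: cvgM; [exact: cvg_id|exact: cvg_cst]].
apply: (@connected_component_max _ A (g @` `[0, 1]) z).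
- exists 0; first by rewrite /= in_itv/= lexx ler01.
  by rewrite /g !mul0r !addr0; case: z {zeA zew g cg}.
- move=> _ [t + <-]; rewrite /= in_itv/= => /andP[t0 t1]; apply: zeA.
  have h (x y : R) : `|x - y| < e -> `|x - (x + t * (y - x))| < e.
    move=> xy; rewrite opprD addrA subrr add0r normrN normrM ger0_norm//.
    by rewrite distrC (le_lt_trans _ xy)// ler_piMl.
  by case: zew => h1 h2; split; rewrite /ball /=; exact: h.
- apply: connected_continuous_connected; first exact: segment_connected.
  by apply: continuous_subspaceT; exact: cg.
- exists 1; first by rewrite /= in_itv/= lexx ler01.
  by rewrite /g !mul1r addrC subrK [z.2 + _]addrC subrK; case: w {zew g cg}.
Qed.

(** The curve is compact, hence closed, and each component of its complement is
    open; so the bounded components form an open set. *)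
Lemma region_measurable (R : realType) (C : planar_shape R) :
  measurable (region C).
Proof.
apply: measurableU.
  rewrite -[shape_image C]setCK; apply: measurableC; apply: open_measurable_plane.
  by apply: closed_openC; exact: shape_image_closed.
apply: open_measurable_plane; rewrite openE => z [/= zC bz].
have /nbhs_ballP[e /= e0 zeC] : nbhs z (~` shape_image C).
  by apply: open_nbhs_nbhs; split => //; exact/closed_openC/shape_image_closed.
rewrite /interior; apply/nbhs_ballP; exists e => // w zew /=; split.
  exact: zeC.
by rewrite -(same_connected_component (ball_connected_component zeC zew)).
Qed.

Lemma affine_bounded (R : realType) (a b c d : R) (v : R * R)
    (A : set (R * R)) :
  bounded_set A -> bounded_set (affine a b c d v @` A).
Proof.
move=> /pinfty_ex_gt0[M M0 AM].
exists ((`|a| + `|b| + (`|c| + `|d|)) * M + `|v.1| + `|v.2|).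
split=> [|N ltN]; first exact: num_real.
move=> _ [z Az <-]; apply: le_trans (ltW ltN).
have := AM z Az; rewrite /= prod_normE ge_max => /andP[z1 z2].
have lin (m n r : R) :
    `|m * z.1 + n * z.2 + r| <= (`|m| + `|n|) * M + `|r|.
  rewrite (le_trans (ler_normD _ _))// lerD2r (le_trans (ler_normD _ _))//.
  by rewrite !normrM mulrDl lerD// ler_wpM2l.
have h1 := lin a b v.1; have h2 := lin c d v.2.
have nn (x y : R) : 0 <= (`|x| + `|y|) * M.
  by rewrite mulr_ge0 ?addr_ge0// ltW.
have p1 := nn a b; have p2 := nn c d.
have q1 := normr_ge0 v.1; have q2 := normr_ge0 v.2.
rewrite prod_normE ge_max /affine /= mulrDl; apply/andP; split.
  by apply: le_trans h1 _; lra.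
by apply: le_trans h2 _; lra.
Qed.

(** T is a homeomorphism carrying one complement to the other.  The component K
    of T z is pulled back by S into the component of z, so K lies in the T-image
    of a bounded set. *)
Lemma similarity_region (R : realType) (k : R) (T S : R * R -> R * R)
    (C D : planar_shape R) :
  similarity k T -> similarity k^-1 S -> cancel T S -> cancel S T ->
  shape_image D = T @` shape_image C -> T @` region C `<=` region D.
Proof.
move=> simT simS TK SK DC _ [z [zC|[zC bz]] <-].
  by left; rewrite DC; exists z.
right; split=> /=.
  by rewrite DC => -[w wC /(can_inj TK) wz]; apply: zC; rewrite -wz.
set K := connected_component _ (T z).
have KD : K `<=` ~` shape_image D by exact: connected_component_sub.
have SKz : S @` K `<=` connected_component (~` shape_image C) z.
  have [Tz|Tz] := pselect ((~` shape_image D) (T z)); last first.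
    by rewrite /K connected_component_out// image_set0.
  apply: connected_component_max.
  - by exists (T z); [exact: connected_component_refl|exact: TK].
  - by move=> _ [y /KD yD <-] Sy; apply: yD; rewrite DC; exists (S y).
  - apply: connected_continuous_connected; first exact: component_connected.
    by apply: continuous_subspaceT; exact: similarity_continuous simS.
have KT : K `<=` T @` connected_component (~` shape_image C) z.
  by move=> y Ky; exists (S y); [apply: SKz; exists y|exact: SK].
have [p [q [e [v [_ _ TE]]]]] := simT.
have : bounded_set (T @` connected_component (~` shape_image C) z).
  by rewrite TE; exact: affine_bounded.
by move=> [M [Mr MT]]; exists M; split => // N /MT h y /KT; exact: h.
Qed.

Lemma area_similarity (R : realType) (k : R) (T : R * R -> R * R)
    (C D : planar_shape R) :
  0 < k -> similarity k T -> shape_image D = T @` shape_image C ->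
  area D = k ^+ 2 * area C.
Proof.
move=> k0 simT DC.
have [S [simS TK SK]] := similarity_inverse k0 simT.
have CD : shape_image C = S @` shape_image D.
  by rewrite DC image_comp (_ : S \o T = id) ?image_id//; apply/funext.
have CT : region C = T @^-1` region D.
  apply/seteqP; split => z zC /=.
    by apply: (similarity_region simT simS TK SK DC); exists z.
  rewrite -[z]TK; apply: (similarity_region simS _ SK TK CD).
    by rewrite invrK.
  by exists (T z).
have [_ mE] := similarity_measure k0 simT (region_measurable D).
rewrite /area /Rintegral !integral_cst//=; [|exact: region_measurable..].
rewrite !mul1e -mE -CT mulrC.
by case: ((_ \x _)%E _) => [r| |] /=; rewrite ?mul0r// ?gt0_mulye ?gt0_mulNye
  ?lte_fin ?exprn_gt0//= ?mul0r.
Qed.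

(** * Derivatives and arc length on one piece *)

(** A function whose lower derivative is nonnegative everywhere is nondecreasing.
    The condition is the inequality slope >= - e multiplied by (s - t)^2, which
    treats both sides of t at once.

    For fixed e, the supremum m of the points t with f c - f t <= e (t - c) is
    again such a point by the condition on the left of m, and cannot be less
    than d by the condition on the right of m. *)
Lemma le_of_lower_slope (R : realType) (f : R -> R) (c d : R) :
  c <= d ->
  (forall t, t \in `[c, d] -> forall e, 0 < e ->
     \forall s \near t, s \in `[c, d] ->
       - e * (s - t) ^+ 2 <= (f s - f t) * (s - t)) ->
  f c <= f d.
Proof.
move=> cd slope_ge.
suff approx e : 0 < e -> f c - f d <= e * (d - c).
  apply/ler_addgt0Pr => e e0.
  have dc1 : 0 < d - c + 1 by lra.
  have := approx (e / (d - c + 1)) (divr_gt0 e0 dc1).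
  rewrite lerBlDl => /le_trans; apply; rewrite lerD2l.
  rewrite mulrAC ler_pdivrMr// ler_pM2l//; lra.
move=> e0.
pose A : set R := [set t | t \in `[c, d] /\ f c - f t <= e * (t - c)].
have Ac : A c by split; rewrite ?in_itv/= ?lexx//= !subrr mulr0.
have ubA : ubound A d by move=> t []; rewrite in_itv/= => /andP[].
have supA : has_sup A by split; [exists c|exists d].
pose m := sup A.
have cm : c <= m by exact: sup_ubound supA.2 _ Ac.
have md : m <= d by apply: sup_le_ub => //; exists c.
have mcd : m \in `[c, d] by rewrite in_itv/= cm md.
have /nbhs_ballP[r /= r0 mr] := slope_ge m mcd e e0.
have Am : A m.
  split=> //.
  have [a [acd fa] ma] := sup_adherent r0 supA.
  have am : a <= m by apply: sup_ubound supA.2 _ _.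
  have mra : ball m r a.
    by rewrite /ball/= ger0_norm ?subr_ge0//; rewrite -/m in ma; lra.
  have := mr a mra acd.
  move: am; rewrite le_eqVlt => /predU1P[<-//|am].
  have -> : (f a - f m) * (a - m) = (f m - f a) * (m - a) by ring.
  have -> : - e * (a - m) ^+ 2 = - e * (m - a) * (m - a) by ring.
  rewrite ler_pM2r ?subr_gt0// => ?; nra.
have [dm|] := leP d m.
  have -> : d = m by apply/eqP; rewrite eq_le dm.
  by case: Am.
move=> md'; exfalso.
pose s := Num.min d (m + r / 2).
have ms : m < s by rewrite lt_min md' ltrDl divr_gt0.
have sd : s <= d by rewrite ge_min lexx.
have sr : s <= m + r / 2 by rewrite ge_min lexx orbT.
have scd : s \in `[c, d] by rewrite in_itv/= sd andbT; lra.
have msr : ball m r s by rewrite /ball/= distrC gtr0_norm ?subr_gt0//; lra.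
have := mr s msr scd.
rewrite expr2 mulrA ler_pM2r ?subr_gt0// => h.
have : A s by split => //; case: Am => _ h2; nra.
by move=> /(sup_ubound supA.2); rewrite leNgt ms.
Qed.

Lemma derive_on_approx (R : realType) (c d : R) (f : R -> R) (t e : R) :
  derivable_on c d f t -> 0 < e ->
  \forall s \near t, s \in `[c, d] ->
    `|f s - f t - derive_on c d f t * (s - t)| <= e * `|s - t|.
Proof.
move=> df e0.
have /cvgrPdist_le/(_ e e0) :
    slope f t s @[s --> within `[c, d] t^'] --> derive_on c d f t by exact: df.
rewrite near_withinE /= /dnbhs near_withinE.
apply: filterS => s h scd.
have [->|st] := eqVneq s t; first by rewrite !subrr mulr0 subr0 normr0 mulr0.
have st0 : 0 < `|s - t| by rewrite normr_gt0 subr_eq0.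
rewrite -ler_pdivrMr// -normfV -normrM mulrBl mulfK ?subr_eq0// distrC.
exact: h.
Qed.

Section segment_primitive.
Context {R : realType}.
Variables (c d : R) (f : R -> R).
Hypothesis cf : {within `[c, d], continuous f}.

Let P t : R := \int[@lebesgue_measure R]_(x in `[c, t]) f x.

Lemma segment_integrable : (@lebesgue_measure R).-integrable `[c, d] (EFin \o f).
Proof. by apply: continuous_compact_integrable => //; exact: segment_compact. Qed.

Lemma segment_primitive_bounds (s u m M : R) :
  c <= s -> s <= u -> u <= d ->
  (forall x, x \in `[s, u] -> m <= f x <= M) ->
  m * (u - s) <= P u - P s <= M * (u - s).
Proof.
move=> cs su ud mM.
have icu : (@lebesgue_measure R).-integrable `[c, u] (EFin \o f).
  apply: integrableS segment_integrable => //.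
  by apply: subset_itvl; rewrite bnd_simp.
have isu : (@lebesgue_measure R).-integrable `]s, u] (EFin \o f).
  by apply: integrableS icu => //; apply: subset_itvr; rewrite bnd_simp.
rewrite /P Rintegral_itvB ?bnd_simp//.
have icst (r : R) : (@lebesgue_measure R).-integrable `]s, u] (EFin \o cst r).
  apply: (@integrableS _ _ _ (@lebesgue_measure R) `[s, u]) => //.
    by apply: subset_itvr; rewrite bnd_simp.
  apply: continuous_compact_integrable; first exact: segment_compact.
  by apply: continuous_subspaceT => x; exact: cvg_cst.
have cst_int (r : R) :
    \int[@lebesgue_measure R]_(x in `]s, u]) cst r x = r * (u - s).
  rewrite Rintegral_cst//= lebesgue_measure_itv/= lte_fin; congr (_ * _).
  by case: ltgtP su => // -[->]; rewrite subrr.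
rewrite -!cst_int; apply/andP; split; apply: le_Rintegral => //= x;
  rewrite in_itv/= => /andP[sx xu];
  by have /andP[] := mM x ltac:(by rewrite in_itv/= xu ltW).
Qed.

Lemma segment_primitive_approx (t e : R) : t \in `[c, d] -> 0 < e ->
  \forall s \near t, s \in `[c, d] ->
    `|P s - P t - f t * (s - t)| <= e * `|s - t|.
Proof.
move=> tcd e0.
have /subspace_continuousP/(_ t tcd)/cvgrPdist_le/(_ e e0) := cf.
rewrite near_withinE => /nbhs_ballP[r /= r0 tr].
apply/nbhs_ballP; exists r => // s trs scd.
have between x y z : x \in `[c, d] -> y \in `[c, d] -> ball t r x -> ball t r y ->
    z \in `[x, y] -> f t - e <= f z <= f t + e.
  rewrite /ball/= !in_itv/= !ltr_norml => /andP[cx xd] /andP[cy yd]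
    /andP[x1 x2] /andP[y1 y2] /andP[xz zy].
  have : `|f t - f z| <= e.
    apply: tr; rewrite /ball/= ?ltr_norml ?in_itv/=; apply/andP; split; lra.
  by rewrite ler_norml => /andP[z1 z2]; apply/andP; split; lra.
have ttr : ball t r t by exact: ballxx.
move: (tcd) (scd); rewrite !in_itv/= => /andP[ct td] /andP[cs sd].
have [ts|st] := leP t s.
  have /andP[h1 h2] := segment_primitive_bounds ct ts sd
    (fun z => between t s z tcd scd ttr trs).
  rewrite [`|s - t|]ger0_norm ?subr_ge0// ler_norml; apply/andP; split; nra.
have /andP[h1 h2] := segment_primitive_bounds cs (ltW st) td
    (fun z => between s t z scd tcd trs ttr).
rewrite [`|s - t|]ltr0_norm ?subr_lt0// ler_norml; apply/andP; split; nra.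
Qed.

End segment_primitive.

Definition speed (R : realType) (c d : R) (g : R -> R * R) (t : R) : R :=
  Num.sqrt (derive_on c d (xcoord g) t ^+ 2 + derive_on c d (ycoord g) t ^+ 2).

(** The derivatives refer to the whole piece [c, d], only the range of integration
    stops at t; at t = d this is [arc_length c d g]. *)
Definition arc_length_to (R : realType) (c d : R) (g : R -> R * R) (t : R) : R :=
  \int[@lebesgue_measure R]_(x in `[c, t]) speed c d g x.

Lemma speed_continuous (R : realType) (c d : R) (g : R -> R * R) :
  nicely_rectifiable c d g -> {within `[c, d], continuous (speed c d g)}.
Proof.
move=> [[_ /subspace_continuousP cx] [_ /subspace_continuousP cy] _].
apply/subspace_continuousP => t tcd.
apply: (@cvg_comp _ _ _ _ Num.sqrt _ (nbhs _)); last exact: sqrt_continuous.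
have sqr (q : R -> R) (l : R) : q x @[x --> within `[c, d] (nbhs t)] --> l ->
    q x ^+ 2 @[x --> within `[c, d] (nbhs t)] --> l ^+ 2.
  by move=> ql; exact: (cvgM ql ql).
by apply: cvgD; apply: sqr; [exact: cx|exact: cy].
Qed.

(** Cauchy-Schwarz; the defect is the square of u.1 * y - u.2 * x. *)
Lemma dot_le_speed (R : realType) (c d : R) (g : R -> R * R) (u : R * R) (t : R) :
  dot u u = 1 ->
  dot u (derive_on c d (xcoord g) t, derive_on c d (ycoord g) t) <= speed c d g t.
Proof.
rewrite /dot /speed /=; set x := derive_on _ _ _ _; set y := derive_on _ _ _ _.
move=> u1; apply: le_trans (ler_norm _) _; rewrite -sqrtr_sqr ler_wsqrtr//.
have := sqr_ge0 (u.1 * y - u.2 * x); nra.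
Qed.

Lemma dot_approx (R : realType) (c d : R) (g : R -> R * R) (u : R * R) (t e : R) :
  nicely_rectifiable c d g -> dot u u = 1 -> t \in `[c, d] -> 0 < e ->
  \forall s \near t, s \in `[c, d] ->
    `|dot u (g s) - dot u (g t) -
      dot u (derive_on c d (xcoord g) t, derive_on c d (ycoord g) t) * (s - t)|
    <= e * `|s - t|.
Proof.
move=> [[dx _] [dy _] _] u1 tcd e0.
have e20 : 0 < e / 2 by rewrite divr_gt0.
near=> s => scd.
have hx : `|xcoord g s - xcoord g t - derive_on c d (xcoord g) t * (s - t)|
    <= e / 2 * `|s - t|.
  by move: scd; near: s; exact: derive_on_approx (dx t tcd) e20.
have hy : `|ycoord g s - ycoord g t - derive_on c d (ycoord g) t * (s - t)|
    <= e / 2 * `|s - t|.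
  by move: scd; near: s; exact: derive_on_approx (dy t tcd) e20.
have u1le : `|u.1| <= 1.
  rewrite -ler_sqr ?nnegrE//= real_normK ?num_real// expr1n -u1 /dot -!expr2.
  by rewrite lerDl sqr_ge0.
have u2le : `|u.2| <= 1.
  rewrite -ler_sqr ?nnegrE//= real_normK ?num_real// expr1n -u1 /dot -!expr2.
  by rewrite lerDr sqr_ge0.
rewrite /dot /=.
have -> : u.1 * (g s).1 + u.2 * (g s).2 - (u.1 * (g t).1 + u.2 * (g t).2) -
    (u.1 * derive_on c d (xcoord g) t + u.2 * derive_on c d (ycoord g) t) * (s - t)
  = u.1 * (xcoord g s - xcoord g t - derive_on c d (xcoord g) t * (s - t)) +
    u.2 * (ycoord g s - ycoord g t - derive_on c d (ycoord g) t * (s - t)).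
  by rewrite /xcoord /ycoord; ring.
rewrite (le_trans (ler_normD _ _))// !normrM [e]splitr mulrDl lerD//.
  by rewrite (le_trans _ hx)// ler_piMl.
by rewrite (le_trans _ hy)// ler_piMl.
Unshelve. all: by end_near. Qed.

Lemma slope_bounds (R : realType) (a m h e : R) :
  `|a - m * h| <= e * `|h| -> (m - e) * h ^+ 2 <= a * h <= (m + e) * h ^+ 2.
Proof.
move=> amh.
have : `|(a - m * h) * h| <= e * h ^+ 2.
  rewrite normrM -(real_normK (num_real h)) expr2 mulrA.
  by apply: ler_wpM2r.
by rewrite ler_norml => /andP[h1 h2]; apply/andP; split; lra.
Qed.

(** The arc length has derivative the speed, which bounds the derivative of the
    coordinate along u; so their difference has nonnegative lower slope. *)
Lemma dot_le_arc_length (R : realType) (c d : R) (g : R -> R * R) (u : R * R)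
    (s t : R) :
  nicely_rectifiable c d g -> dot u u = 1 -> c <= s -> s <= t -> t <= d ->
  dot u (g t) - dot u (g s) <= arc_length_to c d g t - arc_length_to c d g s.
Proof.
move=> nice u1 cs st td.
suff : arc_length_to c d g s - dot u (g s) <= arc_length_to c d g t - dot u (g t).
  by lra.
have sub x : x \in `[s, t] -> x \in `[c, d].
  by rewrite !in_itv/= => /andP[sx xt]; rewrite (le_trans cs)// (le_trans xt).
apply: (le_of_lower_slope
  (f := fun x => arc_length_to c d g x - dot u (g x))) => //.
move=> x /sub xcd e e0.
have e20 : 0 < e / 2 by rewrite divr_gt0.
near=> y => /sub ycd.
have /slope_bounds/andP[hL _] :
    `|arc_length_to c d g y - arc_length_to c d g x -
      speed c d g x * (y - x)| <= e / 2 * `|y - x|.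
  move: ycd; near: y.
  exact: (segment_primitive_approx (speed_continuous nice) xcd e20).
have /slope_bounds/andP[_ hu] :
    `|dot u (g y) - dot u (g x) -
      dot u (derive_on c d (xcoord g) x, derive_on c d (ycoord g) x) * (y - x)|
    <= e / 2 * `|y - x|.
  by move: ycd; near: y; exact: dot_approx nice u1 xcd e20.
have us := dot_le_speed c d g x u1.
have := ler_wpM2r (sqr_ge0 (y - x)) us; lra.
Unshelve. all: by end_near. Qed.

Lemma norm_dot_le_arc_length (R : realType) (c d : R) (g : R -> R * R)
    (u : R * R) (s t : R) :
  nicely_rectifiable c d g -> dot u u = 1 -> c <= s -> s <= t -> t <= d ->
  `|dot u (g t) - dot u (g s)| <= arc_length_to c d g t - arc_length_to c d g s.
Proof.
move=> nice u1 cs st td; rewrite ler_norml lerNl.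
rewrite (dot_le_arc_length nice u1 cs st td) andbT.
have Nu1 : dot (- u) (- u) = 1 by rewrite -u1 /dot /= !mulrNN.
have := dot_le_arc_length nice Nu1 cs st td.
by rewrite /dot /= !mulNr; lra.
Qed.

(** Bounds by displacements in all directions add up to a bound by the arc length:
    at each point choose u tangent to g, so that the coordinate along u has slope
    equal to the speed there; then f minus k times the arc length has nonnegative
    lower slope.  The tangent direction exists as the derivative never vanishes. *)
Lemma arc_length_le (R : realType) (c d k : R) (g : R -> R * R) (f : R -> R) :
  nicely_rectifiable c d g -> c <= d -> 0 < k ->
  (forall u, dot u u = 1 -> forall s t, c <= s -> s < t -> t <= d ->
     k * `|dot u (g t) - dot u (g s)| <= f t - f s) ->
  k * arc_length c d g <= f d - f c.
Proof.
move=> nice cd k0 kf.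
have -> : arc_length c d g = arc_length_to c d g d - arc_length_to c d g c.
  rewrite /arc_length_to set_itv1.
  by rewrite (Rintegral_set1 (speed c d g) c) subr0.
suff : f c - k * arc_length_to c d g c <= f d - k * arc_length_to c d g d.
  by rewrite mulrBr; lra.
apply: (le_of_lower_slope (f := fun x => f x - k * arc_length_to c d g x)) => //.
move=> x xcd e e0.
have e20 : 0 < e / (2 * k) by rewrite divr_gt0// mulr_gt0.
have s0 : 0 < speed c d g x.
  rewrite sqrtr_gt0 lt_neqAle addr_ge0 ?sqr_ge0// andbT eq_sym.
  rewrite paddr_eq0 ?sqr_ge0// !sqrf_eq0; apply/negP => /andP[/eqP x0 /eqP y0].
  by case: nice => _ _ /(_ x xcd); apply.
have s2 : speed c d g x ^+ 2 =
    derive_on c d (xcoord g) x ^+ 2 + derive_on c d (ycoord g) x ^+ 2.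
  by rewrite sqr_sqrtr// addr_ge0 ?sqr_ge0.
pose u := (derive_on c d (xcoord g) x / speed c d g x,
           derive_on c d (ycoord g) x / speed c d g x).
have u1 : dot u u = 1.
  transitivity (speed c d g x ^+ 2 / speed c d g x ^+ 2).
    by rewrite {1}s2 /dot /u /=; field; exact: lt0r_neq0.
  by rewrite divff// expf_neq0// lt0r_neq0.
have us : dot u (derive_on c d (xcoord g) x, derive_on c d (ycoord g) x) =
    speed c d g x.
  transitivity (speed c d g x ^+ 2 / speed c d g x).
    by rewrite s2 /dot /u /=; ring.
  by rewrite expr2 mulfK ?lt0r_neq0.
near=> y => ycd.
have /slope_bounds/andP[_ hL] :
    `|arc_length_to c d g y - arc_length_to c d g x -
      speed c d g x * (y - x)| <= e / (2 * k) * `|y - x|.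
  move: ycd; near: y.
  exact: (segment_primitive_approx (speed_continuous nice) xcd e20).
have /slope_bounds/andP[hu _] :
    `|dot u (g y) - dot u (g x) - speed c d g x * (y - x)|
    <= e / (2 * k) * `|y - x|.
  by rewrite -us; move: ycd; near: y; exact: dot_approx nice u1 xcd e20.
have hf : k * ((dot u (g y) - dot u (g x)) * (y - x)) <= (f y - f x) * (y - x).
  move: (xcd) (ycd); rewrite !in_itv/= => /andP[cx xd] /andP[cy yd].
  rewrite mulrA; have [xy|yx|->] := ltgtP x y; last by rewrite !subrr !mulr0.
  - rewrite ler_pM2r ?subr_gt0//; apply: le_trans (kf u u1 x y cx xy yd).
    by rewrite ler_pM2l// ler_norm.
  - rewrite -(opprB x y) !mulrN lerN2 ler_pM2r ?subr_gt0//.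
    have := kf u u1 y x cy yx xd.
    rewrite -normrN opprB => h; have := ler_norm (dot u (g y) - dot u (g x)).
    rewrite distrC in h.
    have := ler_norm (dot u (g x) - dot u (g y)); nra.
have hL' := ler_wpM2l (ltW k0) hL; have hu' := ler_wpM2l (ltW k0) hu.
have eE a : k * ((a + e / (2 * k)) * (y - x) ^+ 2) =
    k * a * (y - x) ^+ 2 + e / 2 * (y - x) ^+ 2.
  by field; exact: lt0r_neq0.
have eE' a : k * ((a - e / (2 * k)) * (y - x) ^+ 2) =
    k * a * (y - x) ^+ 2 - e / 2 * (y - x) ^+ 2.
  by field; exact: lt0r_neq0.
rewrite eE in hL'; rewrite eE' in hu'.
have -> : (f y - k * arc_length_to c d g y - (f x - k * arc_length_to c d g x)) *
    (y - x) = (f y - f x) * (y - x) -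
      k * ((arc_length_to c d g y - arc_length_to c d g x) * (y - x)) by ring.
lra.
Unshelve. all: by end_near. Qed.

(** An injective curve is displaced between s and the midpoint of s and t, in the
    direction of one of the axes at least.  The midpoint is used because t may be
    the excluded end d, where a closed curve returns to its start. *)
Lemma arc_length_to_lt (R : realType) (c d : R) (g : R -> R * R) (s t : R) :
  nicely_rectifiable c d g -> {in `[c, d[ &, injective g} ->
  c <= s -> s < t -> t <= d ->
  arc_length_to c d g s < arc_length_to c d g t.
Proof.
move=> nice inj cs st td.
have [m sm mt] : exists2 m, s < m & m < t by exists ((s + t) / 2); lra.
have gsm : g s <> g m.
  by move/inj; rewrite !in_itv/= => /(_ ltac:(lra) ltac:(lra)) smE; lra.
have [u u1 usm] : exists2 u : R * R, dot u u = 1 & 0 < `|dot u (g m) - dot u (g s)|.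
  have [E|NE] := eqVneq (g s).1 (g m).1.
    exists (0, 1); first by rewrite /dot /=; ring.
    rewrite /dot /= !mul0r !mul1r !add0r normr_gt0 subr_eq0.
    by apply/eqP => E2; apply: gsm; apply: injective_projections.
  exists (1, 0); first by rewrite /dot /=; ring.
  by rewrite /dot /= !mul0r !mul1r !addr0 normr_gt0 subr_eq0 eq_sym.
have h1 := norm_dot_le_arc_length nice u1 cs (ltW sm) (le_trans (ltW mt) td).
have h2 := norm_dot_le_arc_length nice u1 (le_trans cs (ltW sm)) (ltW mt) td.
have := normr_ge0 (dot u (g t) - dot u (g m)); lra.
Qed.

Lemma arc_length_to_continuous (R : realType) (c d : R) (g : R -> R * R) :
  nicely_rectifiable c d g -> c <= d ->
  {within `[c, d], continuous (arc_length_to c d g)}.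
Proof.
move=> nice cd; apply: parameterized_integral_continuous => //.
exact/segment_integrable/speed_continuous.
Qed.

(** * Length of the part of a shape in a set *)

(** The Lebesgue measure is the restriction to Borel sets of this outer measure,
    whose monotonicity and subadditivity hold for arbitrary sets. *)
Local Notation outer_leb R := ((wlength (@idfun R))^*%mu).

(** The set lies in the interval of length r that starts at its infimum. *)
Lemma lebesgue_measure_diameter (R : realType) (A : set R) (r : R) :
  0 <= r -> (forall x y, A x -> A y -> x - y <= r) ->
  (leb A <= r%:E)%E.
Proof.
move=> r0 Ar; have [->|/set0P[x0 Ax0]] := eqVneq A set0.
  by rewrite measure0 lee_fin.
have lbA : has_lbound A.
  by exists (x0 - r) => x Ax; have := Ar x0 x Ax0 Ax; lra.
have sub : A `<=` `[inf A, inf A + r].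
  move=> x Ax; rewrite /= in_itv/= ge_inf//= -lerBlDr.
  by apply: lb_le_inf; [exists x0|move=> y Ay; have := Ar x y Ax Ay; lra].
apply: (@le_trans _ _ (leb `[inf A, inf A + r])).
  exact: (le_outer_measure (outer_leb R)).
rewrite lebesgue_measure_itv/= lte_fin; case: ifPn => _.
  by rewrite -EFinD lee_fin addrAC subrr add0r.
by rewrite lee_fin.
Qed.

(** From a cover of F(E) by intervals A k, the sets f(E /\ F^-1(A k)) cover f(E),
    and the diameter of each is at most the length of A k. *)
Lemma lebesgue_measure_contraction (R : realType) (f F : R -> R) (E : set R) :
  (forall s t, E s -> E t -> `|f s - f t| <= `|F s - F t|) ->
  (leb (f @` E) <= leb (F @` E))%E.
Proof.
move=> fF; apply: le_ereal_inf_tmp => _ [A [mA FA] <-].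
pose B k := f @` (E `&` F @^-1` A k).
have fB : f @` E `<=` \bigcup_k B k.
  move=> _ [t Et <-]; have [|k _ Akt] := FA (F t); first by exists t.
  by exists k => //; exists t.
apply: le_trans (le_outer_measure (outer_leb R) _ _ fB) _.
apply: le_trans (outer_measure_sigma_subadditive (outer_leb R) B) _.
apply: lee_nneseries => // k _.
have [[a b] _ AE] := mA k; rewrite -AE /=.
have [ab|ba] := leP b a; last first.
  rewrite wlength_itv/= lte_fin ba -EFinB.
  apply: (@lebesgue_measure_diameter R (B k)); first by lra.
  move=> _ _ [s [Es +] <-] [t [Et +] <-]; rewrite /= -AE /= !in_itv/=.
  move=> /andP[s1 s2] /andP[t1 t2].
  apply: le_trans (ler_norm _) _; apply: le_trans (fF _ _ Es Et) _.
  by rewrite ler_norml; apply/andP; split; lra.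
have -> : B k = set0.
  rewrite -subset0 => x [t [_ +] _]; rewrite /= -AE /= in_itv/= => /andP[t1 t2].
  by have := lt_le_trans t1 (le_trans t2 ab); rewrite ltxx.
by rewrite outer_measure0 wlength_ge0.
Qed.

(** Throughout, b 0 = lo < b 1 < ... < b n = hi are the points of subdivision. *)
Section length_on_a_shape.
Context {R : realType}.
Variable D : planar_shape R.

Let h := curve D.
Let n := size (breaks D).
Let b i := nth (hi D) (lo D :: breaks D) i.

Lemma break_lt i : (i < n)%N -> b i < b i.+1.
Proof.
by move=> ni; have [/pathP-/(_ (hi D) i ni)] := breaks_partition D.
Qed.

Lemma break_ge i : (i <= n)%N -> lo D <= b i.
Proof. by move=> ni; exact: itv_partition_nth_ge (breaks_partition D). Qed.

Lemma break_le i : (i <= n)%N -> b i <= hi D.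
Proof. by move=> ni; exact: itv_partition_nth_le (breaks_partition D). Qed.

Lemma break_size : b n = hi D.
Proof. exact: itv_partition_nth_size (breaks_partition D). Qed.

Lemma breaks_gt0 : (0 < n)%N.
Proof.
rewrite lt0n; apply/eqP => n0; have := lo_lt_hi D.
by rewrite -break_size n0 /b /= ltxx.
Qed.

Lemma piece_cover t : lo D <= t -> t <= hi D ->
  exists2 i, (i < n)%N & b i <= t <= b i.+1.
Proof.
move=> lot thi.
have ex : exists i, t <= b i.+1.
  by exists n.-1; rewrite prednK ?breaks_gt0// break_size.
case: (ex_minnP ex) => i ti imin; exists i.
  rewrite -[n]prednK ?breaks_gt0// ltnS; apply: imin.
  by rewrite prednK ?breaks_gt0// break_size.
rewrite ti andbT; case: i ti imin => [//|i] ti imin.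
by rewrite leNgt; apply/negP => /ltW /imin; rewrite ltnn.
Qed.

Lemma piece_sub i : (i < n)%N -> `[b i, b i.+1] `<=` `[lo D, hi D].
Proof.
move=> ni x; rewrite /= !in_itv/= => /andP[x1 x2].
by rewrite (le_trans (break_ge (ltnW ni)))// (le_trans x2)// break_le.
Qed.

Lemma piece_simple i : (i < n)%N -> {in `[b i, b i.+1[ &, injective h}.
Proof.
move=> ni; have sub x : x \in `[b i, b i.+1[ -> x \in `[lo D, hi D[.
  rewrite !in_itv/= => /andP[x1 x2].
  by rewrite (le_trans (break_ge (ltnW ni)))// (lt_le_trans x2)// break_le.
by move=> x y /sub xD /sub yD; exact: curve_simple xD yD.
Qed.

(** The one-dimensional Hausdorff measure of the part of the curve in X, in a form
    suited to computation: arc length maps the i-th piece injectively to a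
    segment, and the points of this segment that come from X are measured. *)
Definition length_on (X : set (R * R)) : \bar R :=
  (\sum_(i < n) leb (arc_length_to (b i) (b i.+1) h @`
                     (`[b i, b i.+1] `&` h @^-1` X)))%E.

Lemma length_on_le_perimeter X : (length_on X <= (perimeter D)%:E)%E.
Proof.
rewrite /perimeter -sumEFin; apply: lee_sum => -[i ni] _ /=.
have nice := curve_nice ni.
set L := arc_length_to _ _ _; rewrite -/h -/(b i) -/(b i.+1) in L nice *.
have bb := ltW (break_lt ni).
have Lb : L (b i) = 0.
  by rewrite /L /arc_length_to set_itv1 Rintegral_set1.
have Lge0 t : 0 <= L t by apply: Rintegral_ge0 => x _; exact: sqrtr_ge0.
have u1 : dot (1, 0) (1, 0) = 1 :> R by rewrite /dot /=; ring.
have Lle t : b i <= t -> t <= b i.+1 -> L t <= L (b i.+1).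
  move=> b1 b2; rewrite -subr_ge0.
  exact: le_trans (normr_ge0 _) (norm_dot_le_arc_length nice u1 b1 b2 (lexx _)).
apply: lebesgue_measure_diameter; first exact: Lge0.
move=> _ _ [s [+ _] <-] [t _ <-]; rewrite /= in_itv/= => /andP[s1 s2].
by rewrite -[leRHS]subr0 lerB// Lle.
Qed.

Lemma length_on_fin_num X : length_on X \is a fin_num.
Proof.
rewrite ge0_fin_numE; first exact: le_lt_trans (length_on_le_perimeter X) (ltry _).
by apply: sume_ge0 => i _; exact: (outer_measure_ge0 (outer_leb R)).
Qed.

(** Arc length is injective and continuous on each piece, so K and X become
    disjoint sets of the line, the first of them compact; Caratheodory's criterion
    for this compact set splits the outer measure of the unrolled Y. *)
Lemma length_on_additive K X Y :
  closed K -> K `<=` Y -> X `<=` Y -> K `&` X = set0 ->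
  (length_on K + length_on X <= length_on Y)%E.
Proof.
move=> cK KY XY KX; rewrite /length_on -big_split; apply: lee_sum => -[i ni] _ /=.
have nice := curve_nice ni; rewrite -/h -/(b i) -/(b i.+1) in nice.
set L := arc_length_to _ _ _; set J := `[b i, b i.+1]%classic.
have bb := ltW (break_lt ni).
have ch : {within J, continuous h}.
  exact: continuous_subspaceW (piece_sub ni) (@curve_continuous _ D).
have cL : {within J, continuous L} by exact: arc_length_to_continuous.
have Llt s t : J s -> J t -> s < t -> L s < L t.
  rewrite /J /= !in_itv/= => /andP[s1 s2] /andP[t1 t2] st.
  exact: (arc_length_to_lt nice (piece_simple ni)).
have Linj s t : J s -> J t -> L s = L t -> s = t.
  move=> Js Jt Lst; have [st|ts|//] := ltgtP s t.
    by have := Llt _ _ Js Jt st; rewrite Lst ltxx.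
  by have := Llt _ _ Jt Js ts; rewrite Lst ltxx.
have mK : measurable (L @` (J `&` h @^-1` K)).
  apply: compact_measurable; apply: continuous_compact.
    by apply: continuous_subspaceW cL; exact: subIsetl.
  have /continuous_closedP/(_ _ cK)/closed_subspaceP[V cV VJ] := ch.
  rewrite setIC -VJ setIC; apply: compact_closedI => //; exact: segment_compact.
have splitM : (outer_leb R).-caratheodory (L @` (J `&` h @^-1` K)).
  exact: (@sub_caratheodory _ _ R (wlength (@idfun R)) _ mK).
rewrite [leRHS]splitM.
apply: leeD; apply: (le_outer_measure (outer_leb R)).
  move=> _ [t [Jt Kt] <-]; split; last by exists t.
  by exists t => //; split => //; exact: KY.
move=> _ [t [Jt Xt] <-]; split; first by exists t => //; split => //; exact: XY.
move=> [s [Js Ks]] /(Linj _ _ Js Jt) st.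
by have : set0 (h t) by rewrite -KX; split => //; rewrite -st.
Qed.

(** On each piece the coordinate along u moves by at most the arc length, hence it
    is a contraction of the unrolled piece. *)
Lemma length_on_projection X (u : R * R) :
  X `<=` shape_image D -> dot u u = 1 ->
  (leb (dot u @` X) <= length_on X)%E.
Proof.
move=> XD u1.
pose B i := (dot u \o h) @` (`[b i, b i.+1] `&` h @^-1` X).
have XB : dot u @` X `<=` \big[setU/set0]_(i < n) B i.
  move=> _ [z Xz <-]; have [t + tz] := XD z Xz.
  rewrite /= in_itv/= => /andP[t1 t2].
  have [i ni it] := piece_cover t1 t2.
  rewrite -bigcup_mkord; exists i => //; exists t; last by rewrite /= /h tz.
  by split; rewrite /= ?in_itv// /h tz.
apply: le_trans (le_outer_measure (outer_leb R) _ _ XB) _.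
apply: le_trans (outer_measure_subadditive (outer_leb R) _ _) _.
apply: lee_sum => -[i ni] _ /=.
have nice := curve_nice ni; rewrite -/h -/(b i) -/(b i.+1) in nice.
apply: lebesgue_measure_contraction => s t [+ _] [+ _].
rewrite /= !in_itv/= => /andP[s1 s2] /andP[t1 t2].
have [st|ts] := leP s t.
  rewrite distrC [leRHS]distrC; apply: le_trans (ler_norm _).
  exact: norm_dot_le_arc_length.
apply: le_trans (ler_norm _).
by apply: norm_dot_le_arc_length => //; exact: ltW.
Qed.

Lemma perimeter_gt0 : 0 < perimeter D.
Proof.
rewrite /perimeter; set al := fun i : 'I_n => arc_length (b i) (b i.+1) h.
have al0 i : 0 < al i.
  have ni := ltn_ord i; have nice := curve_nice ni.
  have := arc_length_to_lt nice (piece_simple ni) (lexx _) (break_lt ni) (lexx _).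
  apply: le_lt_trans.
  by apply: Rintegral_ge0 => x _; exact: sqrtr_ge0.
rewrite (bigD1 (Ordinal breaks_gt0)) //=; apply: ltr_wpDr.
  by apply: sumr_ge0 => i _; exact: ltW (al0 i).
exact: (al0 (Ordinal breaks_gt0)).
Qed.

End length_on_a_shape.

(** * Perimeters of similar shapes *)

(** By the intermediate value theorem the image contains the open interval between
    f s and f t. *)
Lemma segment_image_measure (R : realType) (f : R -> R) (s t : R) :
  s < t -> {within `[s, t], continuous f} ->
  (`|f t - f s|%:E <= leb (f @` `]s, t[))%E.
Proof.
move=> st cf.
pose m := Num.min (f s) (f t); pose M := Num.max (f s) (f t).
have sub : `]m, M[ `<=` f @` `]s, t[.
  move=> y; rewrite /= in_itv/= => /andP[my yM].
  have mM : m <= y <= M by rewrite !ltW.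
  have [x] := IVT (ltW st) cf mM.
  rewrite in_itv/= => /andP[sx xt] fx.
  exists x => //; rewrite /= in_itv/= !lt_neqAle sx xt !andbT.
  apply/andP; split; apply/eqP => E; move: my yM; rewrite -fx.
    rewrite -E /m /M gt_min lt_max !ltxx /= => h1 h2.
    by have := lt_trans h1 h2; rewrite ltxx.
  rewrite E /m /M gt_min lt_max !ltxx !orbF => h1 h2.
  by have := lt_trans h1 h2; rewrite ltxx.
apply: le_trans (le_outer_measure (outer_leb R) _ _ sub).
rewrite [leRHS](lebesgue_measure_itv `]m, M[) /= lte_fin.
rewrite /m /M; case: (ltgtP (f s) (f t)) => [h|h|->].
- by rewrite h -EFinB lee_fin gtr0_norm// subr_gt0.
- by rewrite h -EFinB lee_fin distrC gtr0_norm// subr_gt0.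
- by rewrite subrr normr0 ltxx.
Qed.

(** With phi t the length on D of the image under T of the initial arc of C, the
    growth of phi over [s, t] is at least the length on D of the image of the open
    arc; its projection along v contains an interval of length k times the
    displacement of C along u.  [arc_length_le] turns this into k times the arc
    length of each piece, and the sum over the pieces telescopes. *)
Lemma perimeter_similarity_le (R : realType) (k : R) (T : R * R -> R * R)
    (C D : planar_shape R) :
  0 < k -> similarity k T -> shape_image D = T @` shape_image C ->
  k * perimeter C <= perimeter D.
Proof.
move=> k0 simT DC.
have [S [_ TK _]] := similarity_inverse k0 simT.
pose f := T \o curve C.
have cf a b : lo C <= a -> b <= hi C -> {within `[a, b], continuous f}.
  move=> ca bd; have sub : `[a, b] `<=` `[lo C, hi C].
    by move=> x; rewrite /= !in_itv/= => /andP[ax xb]; apply/andP; split; lra.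
  have /subspace_continuousP cC := continuous_subspaceW sub (@curve_continuous _ C).
  apply/subspace_continuousP => t tab.
  apply: (@cvg_comp _ _ _ _ T _ (nbhs _)); first exact: cC.
  exact: similarity_continuous simT _.
have fD (X : set R) : X `<=` `[lo C, hi C] -> f @` X `<=` shape_image D.
  move=> XC _ [t Xt <-]; rewrite DC; exists (curve C t) => //.
  by exists t => //; exact: XC.
pose phi t := fine (length_on D (f @` `[lo C, t])).
have phi_ge u : dot u u = 1 -> forall s t, lo C <= s -> s < t -> t <= hi C ->
    k * `|dot u (curve C t) - dot u (curve C s)| <= phi t - phi s.
  move=> u1 s t cs st td.
  have [v v1 vT] := similarity_dot k0 simT u1.
  rewrite -[X in X * _](gtr0_norm k0) -normrM -vT.
  (* The open arc leaves out t, which for t = hi C has the same image as lo C. *)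
  have disj : (f @` `[lo C, s]) `&` (f @` `]s, t[) = set0.
    rewrite -subset0 => _ [[x + <-] [y + /(can_inj TK) yx]].
    rewrite /= !in_itv/= => /andP[x1 x2] /andP[y1 y2].
    have : y = x by apply: (@curve_simple _ C) => //; rewrite in_itv/=; lra.
    by move=> E; lra.
  have closed_f : closed (f @` `[lo C, s]).
    apply: compact_closed; first exact: norm_hausdorff.
    apply: continuous_compact; last exact: segment_compact.
    by apply: cf => //; lra.
  have sub1 : f @` `[lo C, s] `<=` f @` `[lo C, t].
    by apply: image_subset => x; rewrite /= !in_itv/= => /andP[x1 x2]; lra.
  have sub2 : f @` `]s, t[ `<=` f @` `[lo C, t].
    by apply: image_subset => x; rewrite /= !in_itv/= => /andP[x1 x2]; lra.
  have sub3 : f @` `]s, t[ `<=` shape_image D.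
    by apply: fD => x; rewrite /= !in_itv/= => /andP[x1 x2]; lra.
  have h1 := length_on_additive D closed_f sub1 sub2 disj.
  have h2 := length_on_projection sub3 v1.
  have cvf : {within `[s, t], continuous (dot v \o f)}.
    have /subspace_continuousP cfst := cf s t cs td.
    apply/subspace_continuousP => x xst.
    apply: (@cvg_comp _ _ _ _ (dot v) _ (nbhs _)); first exact: cfst.
    by apply: cvgD; apply: cvgM; [exact: cvg_cst|exact: cvg_fst|
      exact: cvg_cst|exact: cvg_snd].
  have h3 := segment_image_measure st cvf.
  rewrite image_comp in h2; have h4 := le_trans h3 h2.
  rewrite lerBrDl -lee_fin EFinD /phi !fineK ?length_on_fin_num//.
  by apply: le_trans h1; rewrite leeD2l.
pose b i := nth (hi C) (lo C :: breaks C) i.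
apply: (@le_trans _ _ (\sum_(i < size (breaks C)) (phi (b i.+1) - phi (b i)))).
  rewrite /perimeter mulr_sumr; apply: ler_sum => -[i ni] _ /=.
  apply: (arc_length_le (curve_nice ni) _ k0); first exact: ltW (break_lt ni).
  move=> u u1 s t cs st td; apply: phi_ge => //.
    exact: le_trans (break_ge (ltnW ni)) cs.
  exact: le_trans td (break_le ni).
rewrite -(big_mkord xpredT (fun i => phi (b i.+1) - phi (b i))) telescope_sumr//.
have phi0 : 0 <= phi (b 0%N).
  by rewrite fine_ge0// sume_ge0// => i _; exact: (outer_measure_ge0 (outer_leb R)).
apply: le_trans (_ : phi (b (size (breaks C))) <= _); first by lra.
by rewrite -lee_fin fineK ?length_on_fin_num// length_on_le_perimeter.
Qed.

Lemma perimeter_similarity (R : realType) (k : R) (T : R * R -> R * R)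
    (C D : planar_shape R) :
  0 < k -> similarity k T -> shape_image D = T @` shape_image C ->
  perimeter D = k * perimeter C.
Proof.
move=> k0 simT DC; apply/eqP; rewrite eq_le.
rewrite (perimeter_similarity_le k0 simT DC) andbT.
have [S [simS TK SK]] := similarity_inverse k0 simT.
have CD : shape_image C = S @` shape_image D.
  by rewrite DC image_comp (_ : S \o T = id) ?image_id//; apply/funext.
have kV0 : 0 < k^-1 by rewrite invr_gt0.
by have := perimeter_similarity_le kV0 simS CD; rewrite ler_pdivrMl.
Qed.

(** * Unit shapes *)

Lemma similar_by_measures (R : realType) (k : R) (C D : planar_shape R) :
  0 < k -> similar_by k C D ->
  area D = k ^+ 2 * area C /\ semiperimeter D = k * semiperimeter C.
Proof.
move=> k0 [M [/(scaling_rigid_motion_similarity k) sim DC]]; split.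
  exact: area_similarity sim DC.
by rewrite /semiperimeter (perimeter_similarity k0 sim DC) mulrA.
Qed.

Lemma similar_by_refl (R : realType) (C : planar_shape R) : similar_by 1 C C.
Proof.
exists (translation (0, 0) \o rotation 0); split; first by exists 0, (0, 0); left.
rewrite -[LHS]image_id; congr image; apply/funext => -[x y] /=.
rewrite /scaling /translation /rotation /= sin0 cos0.
by congr pair; ring.
Qed.

Lemma semiperimeter_gt0 (R : realType) (C : planar_shape R) :
  0 < semiperimeter C.
Proof. by rewrite divr_gt0// perimeter_gt0. Qed.

Lemma unit_shape_similar (R : realType) (rho k : R) (U D : planar_shape R) :
  0 < k -> unit_shape U -> similar_by k U D ->
  (rho * area D <= semiperimeter D ^+ 2) = (rho <= fundamental_measure U).
Proof.
move=> k0 U1 /(similar_by_measures k0)[-> ->].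
rewrite /fundamental_measure -U1 exprMn mulrCA ler_pM2l ?exprn_gt0//.
by rewrite expr2 ler_pM2r// U1 semiperimeter_gt0.
Qed.

Theorem proposition5p3 (R : realType) :
  (forall (rho : R) (U : planar_shape R), 0 < rho -> unit_shape U ->
    (rho <= fundamental_measure U <->
     exists (kappa : R) (Uk : planar_shape R),
       [/\ 0 < kappa, similar_by kappa U Uk &
           rho * area Uk <= semiperimeter Uk ^+ 2]) /\
    (rho <= fundamental_measure U <->
     forall (kappa : R) (Uk : planar_shape R),
       0 < kappa -> similar_by kappa U Uk ->
       rho * area Uk <= semiperimeter Uk ^+ 2)) /\
  (forall S : set (planar_shape R),
    (forall C, S C -> forall lambda : R, 0 < lambda ->
       exists D, S D /\ similar_by lambda C D) ->
    forall rho : R, 0 < rho ->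
      (forall U, S U -> unit_shape U -> rho <= fundamental_measure U) ->
      forall C, S C -> rho * area C <= semiperimeter C ^+ 2).
Proof.
split=> [rho U _ U1|S simS rho rho0 rho_le C SC].
  split; split.
  - move=> rhoU; exists 1, U; split=> //; first exact: similar_by_refl.
    by rewrite (unit_shape_similar rho ltr01 U1 (similar_by_refl U)).
  - by move=> [k [D [k0 UD]]]; rewrite (unit_shape_similar rho k0 U1 UD).
  - by move=> rhoU k D k0 UD; rewrite (unit_shape_similar rho k0 U1 UD).
  - move=> /(_ 1 U ltr01 (similar_by_refl U)).
    by rewrite (unit_shape_similar rho ltr01 U1 (similar_by_refl U)).
have s0 := semiperimeter_gt0 C.
have [A0|A0] := leP (area C) 0.
  by apply: (@le_trans _ _ 0); rewrite ?sqr_ge0// pmulr_rle0.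
(* the ratio for which k^2 A = k S *)
have k0 : 0 < semiperimeter C / area C by rewrite divr_gt0.
have [D [SD CD]] := simS C SC _ k0.
have [DA DS] := similar_by_measures k0 CD.
have D1 : unit_shape D.
  by rewrite /unit_shape DA DS; field; rewrite gt_eqF.
have := rho_le D SD D1; rewrite /fundamental_measure D1 DS.
by rewrite mulrAC -expr2 ler_pdivlMr.
Qed.
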